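(* For every positive integer $m$, \[ \lambda(2m+1)=\sum_{k=1}^{m} (-1)^{k-1}\,\lambda(2m-2k+2)\,J(2k-1) \;+\; (-1)^m\,\beta(1)\,J(2m). \]
   Context: The Dirichlet lambda function is $\lambda(s)=\sum_{n=1}^\infty (2n-1)^{-s}$ for $\Re(s)>1$, and the Dirichlet beta function is $\beta(s)=\sum_{n=1}^\infty (-1)^{n-1}(2n-1)^{-s}$ for $\Re(s)>0$ (so $\beta(1)=\pi/4$). For $\Re(s)>0$, define \[ J(s)=\frac{1}{\Gamma(s+1)}\cdot\frac{2}{\pi}\int_0^{\pi/2}\frac{x^s}{\sin x}\,dx . \] *)

(* Defs.v *)
From Stdlib Require Import Reals.
From Coquelicot Require Import Coquelicot.
Open Scope R_scope.

(* All four functions are the restrictions to real arguments of the usual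
   functions of a complex variable.  Coquelicot's [Series] starts at index 0,
   hence the [S n]. *)

Definition dirichlet_lambda (s : R) : R :=
  Series (fun n => Rpower (2 * INR (S n) - 1) (- s)).

Definition dirichlet_beta (s : R) : R :=
  Series (fun n => (-1) ^ n * Rpower (2 * INR (S n) - 1) (- s)).

Definition Gamma (s : R) : R :=
  RInt_gen (fun t => Rpower t (s - 1) * exp (- t))
    (at_right 0) (Rbar_locally p_infty).

(* The integrand is singular at 0 when 0 < s < 1, and [Rpower 0 s] is a junk
   value, so the integral is taken as the limit of integrals over [eps, PI/2]. *)
Definition J (s : R) : R :=
  / Gamma (s + 1) *
  (2 / PI *
   RInt_gen (fun x => Rpower x s / sin x) (at_right 0) (at_point (PI / 2))).

(* Main.v *)
(** On [[0, PI/2]] the Fourier series [sum_n sin ((2n+1) x) / (2n+1)^(2m+1)] is the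
    polynomial [sum_(k=1..m) (-1)^(k-1) lambda(2m-2k+2) x^(2k-1) / (2k-1)!
    + (-1)^m beta(1) x^(2m) / (2m)!]: integrate [sum_n sin ((2n+1) x) / (2n+1) = beta(1)]
    repeatedly from 0, where the constants of integration are values of lambda.
    Dividing by [sin x] and integrating over [[0, PI/2]] gives the theorem, since
    [sin ((2n+1) x) / sin x] has integral [PI/2] for every [n].

    All of this is done on partial sums. There the error of the first integrated series is
    uniformly [O(1/sqrt N)], the later integrations turn it into [O(x^(2m-1)/sqrt N)], and
    this is still integrable after division by [sin x]. *)
Require Import Defs.
From Stdlib Require Import Reals Lra Lia Factorial.
From Coquelicot Require Import Coquelicot.
Open Scope R_scope.

(** * Factorials as values of Gamma *)

(** Both [g + f] and [g - f] have nonnegative derivative, hence increase. Derivatives are required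
    only inside the interval, so that [g] may be a multiple of [sqrt] on an interval starting at
    0. *)
Lemma abs_diff_le_of_derive (f g f' g' : R -> R) (a b : R) :
  a <= b ->
  (forall x, a <= x <= b -> continuous f x) ->
  (forall x, a <= x <= b -> continuous g x) ->
  (forall x, a < x < b -> is_derive f x (f' x)) ->
  (forall x, a < x < b -> is_derive g x (g' x)) ->
  (forall x, a < x < b -> Rabs (f' x) <= g' x) ->
  Rabs (f b - f a) <= g b - g a.
Proof.
  intros Hab cf cg df dg Hle.
  destruct (Req_dec a b) as [<-|Hne].
  { rewrite !Rminus_diag, Rabs_R0. lra. }
  assert (mono : forall h h' : R -> R,
    (forall x, a <= x <= b -> continuous h x) ->
    (forall x, a < x < b -> is_derive h x (h' x)) ->
    (forall x, a < x < b -> 0 <= h' x) -> h a <= h b).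
  { intros h h' ch dh Hh.
    (* [MVT_gen] only places the intermediate point in the closed interval. Replacing [h'] by 0 at
       the endpoints makes the sign known there too. *)
    pose proof (MVT_gen h a b (fun x => if Rlt_dec a x then
      if Rlt_dec x b then h' x else 0 else 0)) as M.
    cbv zeta in M. rewrite Rmin_left, Rmax_right in M by lra.
    destruct M as [c [Hc E]].
    - intros x Hx. destruct (Rlt_dec a x); [|lra]. destruct (Rlt_dec x b); [|lra].
      now apply dh.
    - intros x Hx. apply continuity_pt_filterlim. now apply ch.
    - enough (0 <= h b - h a) by lra. rewrite E.
      apply Rmult_le_pos; [|lra].
      destruct (Rlt_dec a c); [|lra]. destruct (Rlt_dec c b); [|lra].
      now apply Hh. }
  apply Rabs_le. split.
  - enough (g a + f a <= g b + f b) by lra.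
    apply (mono (fun x => g x + f x) (fun x => g' x + f' x)).
    + intros x Hx. apply @continuous_plus; auto.
    + intros x Hx. apply @is_derive_plus; auto.
    + intros x Hx. specialize (Hle x Hx). apply Rabs_le_between in Hle. lra.
  - enough (g a - f a <= g b - f b) by lra.
    apply (mono (fun x => g x - f x) (fun x => g' x - f' x)).
    + intros x Hx. apply @continuous_minus; auto.
    + intros x Hx. apply @is_derive_minus; auto.
    + intros x Hx. specialize (Hle x Hx). apply Rabs_le_between in Hle. lra.
Qed.

Lemma is_derive_continuous (f : R -> R) (x l : R) :
  is_derive f x l -> continuous f x.
Proof. intros H. apply @ex_derive_continuous. now exists l. Qed.

Lemma is_derive_monomial (n : nat) (x : R) :
  is_derive (fun x => x ^ S n / INR (fact (S n))) x (x ^ n / INR (fact n)).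
Proof.
  pose proof (INR_fact_neq_0 n) as Hf. pose proof (not_0_INR (S n) ltac:(lia)) as Hn.
  assert (E : INR (fact (S n)) = INR (S n) * INR (fact n)) by now rewrite <- mult_INR.
  rewrite E. set (c := INR (S n) * INR (fact n)).
  auto_derive; [easy|].
  change (match n with 0%nat => 1 | S _ => INR n + 1 end) with (INR (S n)).
  simpl pred. unfold c. field. split; assumption.
Qed.

(** Integrating the bound for [n] from 0 to [x] gives the bound [exp x - 1] for [S n]. *)
Lemma pow_div_fact_le_exp (n : nat) (x : R) : 0 <= x -> x ^ n / INR (fact n) <= exp x.
Proof.
  revert x; induction n as [|n IH]; intros x Hx.
  - simpl. pose proof (exp_ineq1_le x). lra.
  - assert (de : forall y, is_derive exp y (exp y)) by (intros y; auto_derive; [easy|ring]).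
    pose proof (abs_diff_le_of_derive (fun y => y ^ S n / INR (fact (S n))) exp
      (fun y => y ^ n / INR (fact n)) exp 0 x Hx) as H.
    assert (H0 : 0 ^ S n / INR (fact (S n)) = 0) by (rewrite pow_ne_zero by lia; unfold Rdiv; ring).
    cbv beta in H. rewrite H0, exp_0, Rminus_0_r in H.
    assert (HH : Rabs (x ^ S n / INR (fact (S n))) <= exp x - 1).
    { apply H.
      - intros y _. eapply is_derive_continuous, is_derive_monomial.
      - intros y _. eapply is_derive_continuous, de.
      - intros y _. apply is_derive_monomial.
      - intros y _. apply de.
      - intros y Hy. rewrite Rabs_pos_eq; [apply IH; lra|].
        apply Rmult_le_pos; [apply pow_le; lra|].
        left. apply Rinv_0_lt_compat, INR_fact_lt_0. }
    apply Rabs_le_between in HH. lra.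
Qed.

(** The exponential bound at degree [S n] leaves one spare factor: [t ^ n * exp (- t)] is at most
    [(n+1)! / t]. *)
Lemma is_lim_pow_exp_opp (n : nat) : is_lim (fun t => t ^ n * exp (- t)) p_infty 0.
Proof.
  apply is_lim_le_le_loc with (f := fun _ => 0) (g := fun t => INR (fact (S n)) * / t).
  - exists 0. intros t Ht.
    assert (E : exp (- t) = / exp t) by apply exp_Ropp.
    pose proof (exp_pos t) as He. pose proof (INR_fact_lt_0 (S n)) as Hf.
    split.
    + apply Rmult_le_pos; [apply pow_le; lra|]. left. apply exp_pos.
    + pose proof (pow_div_fact_le_exp (S n) t ltac:(lra)) as H.
      rewrite E. apply Rmult_le_reg_r with (exp t * t); [nra|].
      replace (t ^ n * / exp t * (exp t * t)) with (t ^ S n) by (simpl; field; lra).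
      replace (INR (fact (S n)) * / t * (exp t * t)) with (INR (fact (S n)) * exp t) by (field; lra).
      apply Rmult_le_compat_l with (r := INR (fact (S n))) in H; [|lra].
      replace (INR (fact (S n)) * (t ^ S n / INR (fact (S n)))) with (t ^ S n) in H by (field; lra).
      exact H.
  - apply is_lim_const.
  - replace (Finite 0) with (Rbar_mult (INR (fact (S n))) 0) by (simpl; f_equal; ring).
    apply is_lim_scal_l. apply (is_lim_inv (fun t => t) p_infty p_infty); [apply is_lim_id|easy].
Qed.

(** Integration by parts: the integrand for [S n] is the derivative of [- t ^ S n * exp (- t)],
    whose limits at 0 and at infinity vanish, plus [S n] times the integrand for [n]. *)
Lemma is_RInt_gen_pow_exp_opp (n : nat) :
  is_RInt_gen (fun t => t ^ n * exp (- t)) (at_right 0) (Rbar_locally p_infty) (INR (fact n)).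
Proof.
  assert (cont : forall k x, continuous (fun t => t ^ k * exp (- t)) x).
  { intros k x. apply @ex_derive_continuous. auto_derive. easy. }
  assert (at0 : forall k, filterlim (fun t => t ^ k * exp (- t)) (at_right 0) (locally (0 ^ k * exp (- 0)))).
  { intros k. eapply filterlim_filter_le_1; [|apply (cont k 0)]. apply filter_le_within. }
  induction n as [|n IH].
  - assert (D : forall x, Derive (fun t => - exp (- t)) x = x ^ 0 * exp (- x)).
    { intros x. apply is_derive_unique. auto_derive; [easy|simpl; ring]. }
    apply (is_RInt_gen_ext (Derive (fun t => - exp (- t)))).
    { apply filter_forall. intros ab x _. apply D. }
    replace (INR (fact 0)) with (- 0 - - 1) by (simpl; ring).
    apply is_RInt_gen_Derive.
    + apply filter_forall. intros ab x _. auto_derive. easy.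
    + apply filter_forall. intros ab x _. eapply continuous_ext; [intros y; symmetry; apply D|].
      apply cont.
    + apply (filterlim_comp _ _ _ (fun t => exp (- t)) Ropp _ (locally 1)).
      * specialize (at0 0%nat). rewrite Ropp_0, exp_0 in at0. simpl in at0. rewrite Rmult_1_l in at0.
        eapply filterlim_ext; [|exact at0]. intros t. simpl. ring.
      * apply (filterlim_opp 1).
    + apply (filterlim_comp _ _ _ (fun t => exp (- t)) Ropp _ (locally 0)).
      * pose proof (is_lim_pow_exp_opp 0) as H. unfold is_lim in H.
        eapply filterlim_ext; [|exact H]. intros t. simpl. ring.
      * apply (filterlim_opp 0).
  - assert (D : forall x, Derive (fun t => - (t ^ S n * exp (- t))) x
        = x ^ S n * exp (- x) - INR (S n) * (x ^ n * exp (- x))).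
    { intros x. apply is_derive_unique. auto_derive; [easy|].
      change (match n with 0%nat => 1 | S _ => INR n + 1 end) with (INR (S n)). simpl. ring. }
    apply (is_RInt_gen_ext (fun t => plus (Derive (fun t => - (t ^ S n * exp (- t))) t)
       (scal (INR (S n)) (t ^ n * exp (- t))))).
    { apply filter_forall. intros ab x _. rewrite D. unfold plus, scal, mult; cbn -[INR pow].
      unfold mult; cbn -[INR pow]. ring. }
    replace (INR (fact (S n))) with (plus (- 0 - - 0) (scal (INR (S n)) (INR (fact n)))).
    2:{ rewrite fact_simpl, mult_INR. unfold plus, scal; cbn -[INR]. unfold mult; cbn -[INR]. ring. }
    apply (is_RInt_gen_plus (V := R_NormedModule) (Derive (fun t => - (t ^ S n * exp (- t))))
      (fun t => scal (INR (S n)) (t ^ n * exp (- t))) (- 0 - - 0) (scal (INR (S n)) (INR (fact n))));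
      [|exact (is_RInt_gen_scal _ (INR (S n)) _ IH)].
    apply is_RInt_gen_Derive.
    + apply filter_forall. intros ab x _. auto_derive. easy.
    + apply filter_forall. intros ab x _. eapply continuous_ext; [intros y; symmetry; apply D|].
      apply @continuous_minus; [apply cont|].
      apply @continuous_mult; [apply continuous_const|apply cont].
    + apply (filterlim_comp _ _ _ (fun t => t ^ S n * exp (- t)) Ropp _ (locally 0)).
      * specialize (at0 (S n)). rewrite pow_ne_zero, Rmult_0_l in at0 by lia. exact at0.
      * apply (filterlim_opp 0).
    + apply (filterlim_comp _ _ _ (fun t => t ^ S n * exp (- t)) Ropp _ (locally 0)).
      * exact (is_lim_pow_exp_opp (S n)).
      * apply (filterlim_opp 0).
Qed.

Lemma Gamma_fact (n : nat) : Gamma (INR n + 1) = INR (fact n).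
Proof.
  unfold Gamma. apply is_RInt_gen_unique.
  eapply is_RInt_gen_ext; [|apply is_RInt_gen_pow_exp_opp].
  (* With both endpoints positive, the integration stays where [Rpower] agrees with the integer
     power. *)
  exists (fun a => 0 < a) (fun b => 0 < b).
  - exists (mkposreal 1 Rlt_0_1). now intros y _ Hy.
  - exists 0. now intros.
  - intros a b Ha Hb x Hx. cbn [fst snd] in Hx.
    assert (0 < Rmin a b) by (apply Rmin_pos; assumption).
    replace (INR n + 1 - 1) with (INR n) by ring. rewrite Rpower_pow by lra. reflexivity.
Qed.

(** * Trigonometric sums *)

Lemma Rabs_sin_le (x : R) : 0 <= x -> Rabs (sin x) <= x.
Proof.
  intros Hx.
  pose proof (abs_diff_le_of_derive sin (fun y => y) cos (fun _ => 1) 0 x Hx) as H.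
  cbv beta in H. rewrite sin_0, !Rminus_0_r in H. apply H.
  - intros y _. eapply is_derive_continuous, is_derive_sin.
  - intros y _. apply continuous_id.
  - intros y _. apply is_derive_sin.
  - intros y _. apply @is_derive_id.
  - intros y _. apply Rabs_le. apply COS_bound.
Qed.

(** The Taylor minorant [x - x^3 / 6] is at least [x / 3] as long as [x <= 2]. *)
Lemma sin_ge_third (x : R) : 0 <= x <= PI / 2 -> x / 3 <= sin x.
Proof.
  intros [H0 H1]. pose proof PI_4.
  destruct (pre_sin_bound x 0 H0 ltac:(lra)) as [H2 _].
  eapply Rle_trans; [|exact H2].
  unfold sin_approx, sin_term; simpl.
  enough (x * x * x <= 4 * x) by lra. assert (x <= 2) by lra. nra.
Qed.

Lemma sin_pos_half_PI (x : R) : 0 < x <= PI / 2 -> 0 < sin x.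
Proof. intros H. pose proof PI_RGT_0. apply sin_gt_0; lra. Qed.

Definition odd (n : nat) : R := 2 * INR n + 1.

(** The last index is [N], so there are [S N] terms; this is why [INR (S N)] governs the bounds
    below. *)
Definition sin_sum (p N : nat) (x : R) : R :=
  sum_n (fun n => sin (odd n * x) / odd n ^ p) N.

Definition cos_sum (p N : nat) (x : R) : R :=
  sum_n (fun n => cos (odd n * x) / odd n ^ p) N.

Definition lambda_sum (p N : nat) : R := sum_n (fun n => / odd n ^ p) N.

Definition beta_sum (N : nat) : R := sum_n (fun n => (-1) ^ n / odd n) N.

Lemma odd_ge_1 (n : nat) : 1 <= odd n.
Proof. unfold odd. pose proof (pos_INR n). lra. Qed.

Lemma odd_neq_0 (n : nat) : odd n <> 0.
Proof. pose proof (odd_ge_1 n). lra. Qed.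

Lemma odd_pow_neq_0 (n p : nat) : odd n ^ p <> 0.
Proof. apply pow_nonzero, odd_neq_0. Qed.

Lemma sum_n_opp (u : nat -> R) (N : nat) : sum_n (fun n => - u n) N = - sum_n u N.
Proof.
  induction N as [|N IH]; [now rewrite !sum_O|].
  rewrite !sum_Sn, IH. unfold plus; simpl. ring.
Qed.

Lemma is_derive_sin_sum (p N : nat) (x : R) :
  is_derive (sin_sum (S p) N) x (cos_sum p N x).
Proof.
  apply (is_derive_sum_n (fun n x => sin (odd n * x) / odd n ^ S p)).
  intros n _. pose proof (odd_neq_0 n). pose proof (odd_pow_neq_0 n p).
  auto_derive; [easy|]. simpl. field. auto.
Qed.

Lemma is_derive_cos_sum (p N : nat) (x : R) :
  is_derive (cos_sum (S p) N) x (- sin_sum p N x).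
Proof.
  unfold sin_sum. rewrite <- sum_n_opp.
  apply (is_derive_sum_n (fun n x => cos (odd n * x) / odd n ^ S p)).
  intros n _. pose proof (odd_neq_0 n). pose proof (odd_pow_neq_0 n p).
  auto_derive; [easy|]. simpl. field. auto.
Qed.

Lemma sin_sum_0 (p N : nat) : sin_sum p N 0 = 0.
Proof.
  unfold sin_sum. rewrite (sum_n_ext _ (fun _ => 0)).
  - rewrite sum_n_const. ring.
  - intros n. rewrite Rmult_0_r, sin_0. apply Rmult_0_l.
Qed.

Lemma cos_sum_0 (p N : nat) : cos_sum p N 0 = lambda_sum p N.
Proof.
  unfold cos_sum, lambda_sum. apply sum_n_ext. intros n.
  rewrite Rmult_0_r, cos_0. apply Rmult_1_l.
Qed.

Lemma sin_odd_half_PI (n : nat) : sin (odd n * (PI / 2)) = (-1) ^ n.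
Proof.
  unfold odd. induction n as [|n IH].
  - simpl. replace ((2 * 0 + 1) * (PI / 2)) with (PI / 2) by field. apply sin_PI2.
  - rewrite S_INR.
    replace ((2 * (INR n + 1) + 1) * (PI / 2)) with ((2 * INR n + 1) * (PI / 2) + PI) by field.
    rewrite neg_sin, IH. simpl. ring.
Qed.

Lemma sin_sum_half_PI (N : nat) : sin_sum 1 N (PI / 2) = beta_sum N.
Proof.
  unfold sin_sum, beta_sum. apply sum_n_ext. intros n.
  rewrite sin_odd_half_PI, pow_1. reflexivity.
Qed.

(** The sum telescopes, because [2 sin x cos ((2n+1) x) = sin ((2n+2) x) - sin (2n x)]. *)
Lemma dirichlet_kernel (N : nat) (x : R) :
  2 * sin x * cos_sum 0 N x = sin (2 * INR (S N) * x).
Proof.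
  unfold cos_sum. induction N as [|N IH].
  - rewrite sum_O. unfold odd. simpl. rewrite Rmult_0_r, Rplus_0_l, Rmult_1_l, Rmult_1_r.
    rewrite sin_2a. field.
  - rewrite sum_Sn. change plus with Rplus.
    rewrite Rmult_plus_distr_l, IH. unfold odd. rewrite pow_O.
    set (y := (2 * INR (S N) + 1) * x).
    replace (2 * INR (S N) * x) with (y - x) by (unfold y; ring).
    replace (2 * INR (S (S N)) * x) with (y + x) by (unfold y; rewrite (S_INR (S N)); ring).
    rewrite sin_minus, sin_plus. field.
Qed.

(* Integrating the Dirichlet kernel once by parts: the primitive
   [- cos (2 M x) / (4 M sin x)] leaves an error with derivative
   at most [cos x / (4 M sin^2 x)]. *)
Lemma sin_sum_near_beta_sum (N : nat) (x : R) : 0 < x <= PI / 2 ->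
  Rabs (sin_sum 1 N x - beta_sum N) <= / (2 * INR (S N) * sin x).
Proof.
  intros Hx. set (M := INR (S N)).
  assert (HM : 0 < M) by (apply lt_0_INR; lia).
  assert (Hs : forall y, x <= y <= PI / 2 -> 0 < sin y) by (intros y Hy; apply sin_pos_half_PI; lra).
  set (f := fun y => sin_sum 1 N y + cos (2 * M * y) / (4 * M * sin y)).
  set (g := fun y => - / (4 * M * sin y)).
  assert (df : forall y, x <= y <= PI / 2 ->
    is_derive f y (- (cos (2 * M * y) * cos y / (4 * M * (sin y) ^ 2)))).
  { intros y Hy. specialize (Hs y Hy).
    assert (K : cos_sum 0 N y = sin (2 * M * y) / (2 * sin y)).
    { apply Rmult_eq_reg_l with (2 * sin y); [|lra]. rewrite dirichlet_kernel.
      unfold M. field. lra. }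
    replace (- (cos (2 * M * y) * cos y / (4 * M * (sin y) ^ 2))) with
      (cos_sum 0 N y +
       (- (sin (2 * M * y)) / (2 * sin y) - cos (2 * M * y) * cos y / (4 * M * (sin y) ^ 2)))
      by (rewrite K; field; lra).
    apply @is_derive_plus; [apply is_derive_sin_sum|].
    auto_derive; [nra|]. field. lra. }
  assert (dg : forall y, x <= y <= PI / 2 -> is_derive g y (cos y / (4 * M * (sin y) ^ 2))).
  { intros y Hy. specialize (Hs y Hy). unfold g. auto_derive; [nra|]. field. lra. }
  assert (H : Rabs (f (PI / 2) - f x) <= g (PI / 2) - g x).
  { apply abs_diff_le_of_derive with
      (f' := fun y => - (cos (2 * M * y) * cos y / (4 * M * (sin y) ^ 2)))
      (g' := fun y => cos y / (4 * M * (sin y) ^ 2)).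
    - lra.
    - intros y Hy. eapply is_derive_continuous, df, Hy.
    - intros y Hy. eapply is_derive_continuous, dg, Hy.
    - intros y Hy. apply df. lra.
    - intros y Hy. apply dg. lra.
    - intros y Hy.
      assert (0 <= cos y) by (pose proof PI_RGT_0; apply cos_ge_0; lra).
      assert (0 <= cos y / (4 * M * (sin y) ^ 2)).
      { apply Rmult_le_pos; [assumption|]. left. apply Rinv_0_lt_compat.
        assert (0 < sin y) by (apply Hs; lra).
        assert (0 < sin y ^ 2) by (apply pow_lt; assumption). nra. }
      rewrite Rabs_Ropp. unfold Rdiv. rewrite Rmult_assoc, Rabs_mult.
      rewrite (Rabs_pos_eq (cos y * _)) by assumption.
      rewrite <- (Rmult_1_l (cos y * / (4 * M * sin y ^ 2))) at 2.
      apply Rmult_le_compat_r; [assumption|]. apply Rabs_le, COS_bound. }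
  unfold f, g in H. rewrite sin_PI2, Rmult_1_r, sin_sum_half_PI in H.
  assert (Hsx : 0 < sin x) by (apply Hs; lra).
  set (c1 := cos (2 * M * (PI / 2))) in H. set (c2 := cos (2 * M * x)) in H.
  assert (B1 : Rabs (c1 / (4 * M)) <= / (4 * M)).
  { unfold Rdiv. rewrite Rabs_mult, (Rabs_pos_eq (/ _)) by (left; apply Rinv_0_lt_compat; lra).
    rewrite <- (Rmult_1_l (/ (4 * M))) at 2.
    apply Rmult_le_compat_r; [left; apply Rinv_0_lt_compat; lra|]. apply Rabs_le, COS_bound. }
  assert (B2 : Rabs (c2 / (4 * M * sin x)) <= / (4 * M * sin x)).
  { assert (0 < 4 * M * sin x) by nra.
    unfold Rdiv. rewrite Rabs_mult, (Rabs_pos_eq (/ _)) by (left; apply Rinv_0_lt_compat; lra).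
    rewrite <- (Rmult_1_l (/ (4 * M * sin x))) at 2.
    apply Rmult_le_compat_r; [left; apply Rinv_0_lt_compat; lra|]. apply Rabs_le, COS_bound. }
  (* One of the two halves bounds the boundary term at [x]. The other comes from [g (PI / 2) - g x],
     whose remaining [- / (4 * M)] pays for the boundary term at [PI / 2]. *)
  replace (/ (2 * M * sin x)) with (/ (4 * M * sin x) + / (4 * M * sin x)) by (field; lra).
  apply Rabs_le_between in H, B1, B2. apply Rabs_le. lra.
Qed.

Lemma Rabs_sin_sum_le (N : nat) (x : R) : 0 <= x -> Rabs (sin_sum 1 N x) <= INR (S N) * x.
Proof.
  intros Hx.
  assert (T : forall n, Rabs (sin (odd n * x) / odd n ^ 1) <= x).
  { intros n. pose proof (odd_ge_1 n). rewrite pow_1.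
    unfold Rdiv. rewrite Rabs_mult, (Rabs_pos_eq (/ _)) by (left; apply Rinv_0_lt_compat; lra).
    apply Rmult_le_reg_r with (odd n); [lra|].
    rewrite Rmult_assoc, Rinv_l, Rmult_1_r, Rmult_comm by lra.
    rewrite Rmult_comm. apply Rle_trans with (odd n * x); [apply Rabs_sin_le; nra | lra]. }
  unfold sin_sum. induction N as [|N IH].
  - rewrite sum_O. simpl INR. rewrite Rmult_1_l. apply T.
  - rewrite sum_Sn. change plus with Rplus. rewrite (S_INR (S N)).
    eapply Rle_trans; [apply Rabs_triang|]. specialize (T (S N)). lra.
Qed.

(* Interpolates between the bound [O(1/(M x))] and boundedness near 0, so that the right-hand
   side is integrable at 0. *)
Lemma sin_sum_minus_beta_sum_le (N : nat) (x : R) : 0 < x <= PI / 2 ->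
  Rabs (sin_sum 1 N x - beta_sum N) <= 4 / (sqrt (INR (S N)) * sqrt x).
Proof.
  intros Hx. set (M := INR (S N)).
  assert (HM : 1 <= M) by (unfold M; rewrite S_INR; pose proof (pos_INR N); lra).
  assert (far : forall y, 0 < y <= PI / 2 ->
    Rabs (sin_sum 1 N y - beta_sum N) <= 3 / 2 / (M * y)).
  { intros y Hy. eapply Rle_trans; [apply sin_sum_near_beta_sum, Hy|].
    fold M. pose proof (sin_ge_third y ltac:(lra)) as Hs.
    replace (3 / 2 / (M * y)) with (/ (2 * M * (y / 3))) by (field; lra).
    apply Rinv_le_contravar; nra. }
  assert (Hr : 0 < sqrt (M * x)) by (apply sqrt_lt_R0; nra).
  rewrite <- sqrt_mult by lra.
  assert (E : sqrt (M * x) * sqrt (M * x) = M * x) by (apply sqrt_sqrt; nra).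
  (* For [x <= / M], compare with the point [/ M]: both sine sums are at most 1 in absolute value
     and [far] gives 3/2 at [/ M], in total less than 4. For [M * x > 1], the bound [far] is already
     the stronger one. *)
  destruct (Rle_lt_dec (M * x) 1) as [H1|H1].
  - assert (Hi : 0 < / M <= 1).
    { split; [apply Rinv_0_lt_compat; lra|]. rewrite <- Rinv_1. apply Rinv_le_contravar; lra. }
    pose proof (far (/ M) ltac:(pose proof PI2_1; lra)) as F.
    pose proof (Rabs_sin_sum_le N (/ M) ltac:(lra)) as G. fold M in G.
    pose proof (Rabs_sin_sum_le N x ltac:(lra)) as G'. fold M in G'.
    rewrite Rinv_r in F, G by lra.
    assert (sqrt (M * x) <= 1) by (rewrite <- sqrt_1; apply sqrt_le_1_alt, H1).
    assert (4 <= 4 / sqrt (M * x)).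
    { apply Rmult_le_reg_r with (sqrt (M * x)); [assumption|].
      unfold Rdiv. rewrite Rmult_assoc, Rinv_l by lra. lra. }
    apply Rabs_le_between in F, G, G'. apply Rabs_le. lra.
  - eapply Rle_trans; [apply far, Hx|].
    assert (1 <= sqrt (M * x)) by (rewrite <- sqrt_1; apply sqrt_le_1_alt; lra).
    set (r := sqrt (M * x)) in *. rewrite <- E.
    apply Rmult_le_reg_r with (r * r); [nra|].
    replace (3 / 2 / (r * r) * (r * r)) with (3 / 2) by (field; lra).
    replace (4 / r * (r * r)) with (4 * r) by (field; lra).
    lra.
Qed.

(** The primitive of [4 / (sqrt M * sqrt x)] is [8 * sqrt x / sqrt M], and [sqrt x <= 2] on the
    interval; hence 16. *)
Definition fourier_error (N : nat) : R := 16 / sqrt (INR (S N)).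

Lemma cos_sum_2_error (N : nat) (x : R) : 0 <= x <= PI / 2 ->
  Rabs (cos_sum 2 N x - (lambda_sum 2 N - beta_sum N * x)) <= fourier_error N.
Proof.
  intros Hx.
  assert (HM : 0 < sqrt (INR (S N))) by (apply sqrt_lt_R0, lt_0_INR; lia).
  set (f := fun y => cos_sum 2 N y + beta_sum N * y).
  set (g := fun y => 8 / sqrt (INR (S N)) * sqrt y).
  assert (df : forall y, is_derive f y (- (sin_sum 1 N y - beta_sum N))).
  { intros y. replace (- (sin_sum 1 N y - beta_sum N)) with (- sin_sum 1 N y + beta_sum N) by ring.
    apply @is_derive_plus; [apply is_derive_cos_sum|]. auto_derive; [easy|ring]. }
  assert (H : Rabs (f x - f 0) <= g x - g 0).
  { apply abs_diff_le_of_derive with (f' := fun y => - (sin_sum 1 N y - beta_sum N))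
      (g' := fun y => 4 / (sqrt (INR (S N)) * sqrt y)).
    - lra.
    - intros y _. eapply is_derive_continuous, df.
    - intros y _. apply @continuous_mult; [apply continuous_const|]. apply continuous_sqrt.
    - intros y _. apply df.
    - intros y Hy. assert (0 < sqrt y) by (apply sqrt_lt_R0; lra).
      unfold g. set (r := sqrt (INR (S N))) in *. auto_derive; [lra|]. field. lra.
    - intros y Hy. rewrite Rabs_Ropp. apply sin_sum_minus_beta_sum_le. lra. }
  unfold f, g in H. rewrite cos_sum_0, sqrt_0, !Rmult_0_r, Rplus_0_r, Rminus_0_r in H.
  replace (cos_sum 2 N x - (lambda_sum 2 N - beta_sum N * x))
    with (cos_sum 2 N x + beta_sum N * x - lambda_sum 2 N) by ring.
  eapply Rle_trans; [exact H|]. unfold fourier_error.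
  assert (sqrt x <= 2).
  { rewrite <- (sqrt_square 2) by lra. apply sqrt_le_1_alt. pose proof PI_4. lra. }
  replace (16 / sqrt (INR (S N))) with (8 / sqrt (INR (S N)) * 2) by (field; lra).
  apply Rmult_le_compat_l; [|assumption].
  left. apply Rdiv_lt_0_compat; lra.
Qed.

(** * The polynomial limits and their errors *)

(* Equalities produced by Coquelicot lemmas live in the carrier of a structure, where
   [ring] and [field] do not recognize [R]. *)
Ltac eq_in_R := match goal with |- @eq _ ?a ?b => change (@eq R a b) end.

Definition monomial (n : nat) (x : R) : R := x ^ n / INR (fact n).

Lemma monomial_S_0 (n : nat) : monomial (S n) 0 = 0.
Proof. unfold monomial. rewrite pow_ne_zero by lia. apply Rmult_0_l. Qed.

Lemma sum_n_R0 (u : nat -> R) (n : nat) : (forall k, u k = 0) -> sum_n u n = 0.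
Proof.
  intros H. rewrite (sum_n_ext u (fun _ => 0)) by exact H. rewrite sum_n_const. apply Rmult_0_r.
Qed.

Lemma sum_n_S_l (u : nat -> R) (n : nat) :
  sum_n u (S n) = u 0%nat + sum_n (fun k => u (S k)) n.
Proof. unfold sum_n. rewrite sum_Sn_m by lia. now rewrite sum_n_m_S. Qed.

(* The parameter [p] of the polynomials stands for [m - 1]. *)
Definition sin_poly (p N : nat) (x : R) : R :=
  sum_n (fun k => (-1) ^ k * lambda_sum (2 * (S p - k)) N * monomial (S (2 * k)) x) p
  + (-1) ^ S p * beta_sum N * monomial (S (S (2 * p))) x.

Definition cos_poly (p N : nat) (x : R) : R :=
  sum_n (fun k => (-1) ^ k * lambda_sum (2 * (S p - k)) N * monomial (2 * k) x) p
  + (-1) ^ S p * beta_sum N * monomial (S (2 * p)) x.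

Lemma is_derive_scal_monomial (c : R) (n : nat) (x : R) :
  is_derive (fun x => c * monomial (S n) x) x (c * monomial n x).
Proof. apply @is_derive_scal. apply is_derive_monomial. Qed.

Lemma is_derive_sin_poly (p N : nat) (x : R) :
  is_derive (sin_poly p N) x (cos_poly p N x).
Proof.
  apply @is_derive_plus; [|apply is_derive_scal_monomial].
  apply (is_derive_sum_n (fun k x =>
    (-1) ^ k * lambda_sum (2 * (S p - k)) N * monomial (S (2 * k)) x)).
  intros k _. apply is_derive_scal_monomial.
Qed.

(** Splitting off the constant term and shifting the index shows the rest as [sin_poly p] with every
    sign reversed and every degree raised by one, that is, as a primitive of [- sin_poly p]. *)
Lemma cos_poly_S (p N : nat) (x : R) :
  cos_poly (S p) N x = lambda_sum (2 * S (S p)) N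
    + (sum_n (fun k => - ((-1) ^ k * lambda_sum (2 * (S p - k)) N) * monomial (S (S (2 * k))) x) p
       + - ((-1) ^ S p * beta_sum N) * monomial (S (S (S (2 * p)))) x).
Proof.
  unfold cos_poly. rewrite sum_n_S_l, <- Rplus_assoc. f_equal; [f_equal|].
  - unfold monomial. simpl. field.
  - apply sum_n_ext. intros k. replace (2 * S k)%nat with (S (S (2 * k))) by lia.
    change (S (S p) - S k)%nat with (S p - k)%nat.
    rewrite <- tech_pow_Rmult.
    transitivity (- ((-1) ^ k * lambda_sum (2 * (S p - k)) N) * monomial (S (S (2 * k))) x);
      [|reflexivity]. f_equal. ring.
  - replace (2 * S p)%nat with (S (S (2 * p))) by lia. simpl pow. ring.
Qed.

Lemma is_derive_cos_poly (p N : nat) (x : R) :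
  is_derive (cos_poly (S p) N) x (- sin_poly p N x).
Proof.
  apply (is_derive_ext (fun x => lambda_sum (2 * S (S p)) N
    + (sum_n (fun k => - ((-1) ^ k * lambda_sum (2 * (S p - k)) N) * monomial (S (S (2 * k))) x) p
       + - ((-1) ^ S p * beta_sum N) * monomial (S (S (S (2 * p)))) x))).
  { intros t. symmetry. apply cos_poly_S. }
  replace (- sin_poly p N x) with (0 +
    (sum_n (fun k => - ((-1) ^ k * lambda_sum (2 * (S p - k)) N) * monomial (S (2 * k)) x) p
       + - ((-1) ^ S p * beta_sum N) * monomial (S (S (2 * p))) x)).
  2:{ unfold sin_poly. rewrite Rplus_0_l, Ropp_plus_distr, <- sum_n_opp. f_equal; [|ring].
      apply sum_n_ext. intros k. apply Ropp_mult_distr_l_reverse. }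
  apply @is_derive_plus; [apply @is_derive_const|].
  apply @is_derive_plus; [|apply is_derive_scal_monomial].
  apply (is_derive_sum_n (fun k x =>
    - ((-1) ^ k * lambda_sum (2 * (S p - k)) N) * monomial (S (S (2 * k))) x)).
  intros k _. apply is_derive_scal_monomial.
Qed.

Lemma sin_poly_0 (p N : nat) : sin_poly p N 0 = 0.
Proof.
  unfold sin_poly. rewrite monomial_S_0, sum_n_R0; [ring|].
  intros k. rewrite monomial_S_0. ring.
Qed.

Lemma cos_poly_S_0 (p N : nat) : cos_poly (S p) N 0 = lambda_sum (2 * S (S p)) N.
Proof.
  rewrite cos_poly_S, monomial_S_0, sum_n_R0; [ring|].
  intros k. rewrite monomial_S_0. ring.
Qed.

(** One integration from 0. The factorial inside [monomial] absorbs the constant, so [eps] is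
    unchanged however often this is iterated. *)
Lemma error_of_derive_error (f f' : R -> R) (eps x : R) (n : nat) : 0 <= x <= PI / 2 ->
  f 0 = 0 -> (forall y, is_derive f y (f' y)) ->
  (forall y, 0 <= y <= PI / 2 -> Rabs (f' y) <= eps * monomial n y) ->
  Rabs (f x) <= eps * monomial (S n) x.
Proof.
  intros Hx f0 df Hle.
  replace (f x) with (f x - f 0) by (rewrite f0; ring).
  replace (eps * monomial (S n) x) with (eps * monomial (S n) x - eps * monomial (S n) 0)
    by (rewrite monomial_S_0; ring).
  apply (abs_diff_le_of_derive f (fun x => eps * monomial (S n) x) f' (fun x => eps * monomial n x)).
  - lra.
  - intros y _. eapply is_derive_continuous, df.
  - intros y _. eapply is_derive_continuous, is_derive_scal_monomial.
  - intros y _. apply df.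
  - intros y _. apply is_derive_scal_monomial.
  - intros y Hy. apply Hle. lra.
Qed.

(** Kept as an implication because it serves twice: as the first half of the induction step for the
    cosine sums, and afterwards to conclude for the sine sums. *)
Lemma sin_sum_error_of_cos_sum_error (p N : nat) :
  (forall x, 0 <= x <= PI / 2 ->
     Rabs (cos_sum (2 * S p) N x - cos_poly p N x) <= fourier_error N * monomial (2 * p) x) ->
  forall x, 0 <= x <= PI / 2 ->
     Rabs (sin_sum (S (2 * S p)) N x - sin_poly p N x) <= fourier_error N * monomial (S (2 * p)) x.
Proof.
  intros H x Hx.
  apply (error_of_derive_error (fun x => sin_sum (S (2 * S p)) N x - sin_poly p N x)
    (fun x => cos_sum (2 * S p) N x - cos_poly p N x)); [exact Hx| | |exact H].
  - rewrite sin_sum_0, sin_poly_0. ring.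
  - intros y. apply @is_derive_minus; [apply is_derive_sin_sum|apply is_derive_sin_poly].
Qed.

(** Each step of the induction integrates twice, from cosine to sine and back to cosine. The values
    at 0 agree exactly: the constant term of [cos_poly] is the partial sum of lambda. *)
Lemma cos_sum_error (p N : nat) (x : R) : 0 <= x <= PI / 2 ->
  Rabs (cos_sum (2 * S p) N x - cos_poly p N x) <= fourier_error N * monomial (2 * p) x.
Proof.
  revert x; induction p as [|p IH]; intros x Hx.
  - replace (cos_poly 0 N x) with (lambda_sum 2 N - beta_sum N * x)
      by (unfold cos_poly, monomial; rewrite sum_O; simpl; field).
    replace (fourier_error N * monomial (2 * 0) x) with (fourier_error N)
      by (unfold monomial; simpl; field).
    now apply cos_sum_2_error.
  - pose proof (sin_sum_error_of_cos_sum_error p N IH) as H.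
    replace (monomial (2 * S p) x) with (monomial (S (S (2 * p))) x) by (f_equal; lia).
    apply (error_of_derive_error (fun x => cos_sum (2 * S (S p)) N x - cos_poly (S p) N x)
      (fun x => - (sin_sum (S (2 * S p)) N x - sin_poly p N x))); [exact Hx| | |].
    + rewrite cos_sum_0, cos_poly_S_0. ring.
    + intros y. replace (2 * S (S p))%nat with (S (S (2 * S p))) by lia.
      replace (- (sin_sum (S (2 * S p)) N y - sin_poly p N y))
        with (- sin_sum (S (2 * S p)) N y - - sin_poly p N y) by ring.
      apply @is_derive_minus; [apply is_derive_cos_sum|apply is_derive_cos_poly].
    + intros y Hy. rewrite Rabs_Ropp. now apply H.
Qed.

Lemma sin_sum_error (p N : nat) (x : R) : 0 <= x <= PI / 2 ->
  Rabs (sin_sum (S (2 * S p)) N x - sin_poly p N x) <= fourier_error N * monomial (S (2 * p)) x.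
Proof. apply sin_sum_error_of_cos_sum_error. intros y. apply cos_sum_error. Qed.

(** * Integrals against 1 / sin *)

Lemma is_RInt_sum_n (f : nat -> R -> R) (l : nat -> R) (a b : R) (n : nat) :
  (forall k, is_RInt (f k) a b (l k)) ->
  is_RInt (fun x => sum_n (fun k => f k x) n) a b (sum_n l n).
Proof.
  intros H. induction n as [|n IH].
  - rewrite sum_O. apply (is_RInt_ext (f 0%nat)); [|apply H]. intros x _. now rewrite sum_O.
  - rewrite sum_Sn.
    apply (is_RInt_ext (fun x => plus (sum_n (fun k => f k x) n) (f (S n) x))).
    + intros x _. now rewrite sum_Sn.
    + exact (is_RInt_plus _ _ a b _ _ IH (H (S n))).
Qed.

Lemma is_RInt_Rmult_l (f : R -> R) (a b c l : R) :
  is_RInt f a b l -> is_RInt (fun x => c * f x) a b (c * l).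
Proof. exact (is_RInt_scal f a b c l). Qed.

Lemma sum_n_Rmult_r (u : nat -> R) (c : R) (n : nat) :
  sum_n u n * c = sum_n (fun k => u k * c) n.
Proof. symmetry. exact (sum_n_mult_r (K := R_Ring) c u n). Qed.

(** Consecutive integrands differ by [2 cos ((2n+2) x)], whose integral over the interval is 0 since
    [sin ((n+1) PI) = 0]. *)
Lemma is_RInt_sin_odd_div_sin (n : nat) :
  is_RInt (fun x => sin (odd n * x) / sin x) 0 (PI / 2) (PI / 2).
Proof.
  pose proof PI_RGT_0 as HPI.
  (* Integrands are compared on the open interval only, so the value of the quotient at 0, a
     division by zero, does not enter. *)
  assert (Hs : forall x, Rmin 0 (PI / 2) < x < Rmax 0 (PI / 2) -> sin x <> 0).
  { intros x. rewrite Rmin_left, Rmax_right by lra. intros Hx.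
    apply Rgt_not_eq, sin_pos_half_PI. lra. }
  induction n as [|n IH].
  - apply (is_RInt_ext (fun _ => 1)).
    + intros x Hx. specialize (Hs x Hx). unfold odd. simpl.
      replace ((2 * 0 + 1) * x) with x by ring. eq_in_R. field. exact Hs.
    + replace (PI / 2) with (scal (PI / 2 - 0) 1) at 2; [apply (is_RInt_const 0 (PI / 2) 1)|].
      unfold scal; simpl. unfold mult; simpl. eq_in_R. ring.
  - set (c := 2 * INR (S n)).
    assert (Hc : c <> 0) by (unfold c; pose proof (lt_0_INR (S n) ltac:(lia)); lra).
    apply (is_RInt_ext (fun x => plus (sin (odd n * x) / sin x) (2 * cos (c * x)))).
    + intros x Hx. specialize (Hs x Hx). change plus with Rplus.
      replace (odd n * x) with (c * x - x) by (unfold c, odd; rewrite S_INR; ring).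
      replace (odd (S n) * x) with (c * x + x) by (unfold c, odd; ring).
      rewrite sin_minus, sin_plus. eq_in_R. field. exact Hs.
    + replace (PI / 2) with (plus (PI / 2) 0) at 2 by apply Rplus_0_r.
      apply (is_RInt_plus (V := R_NormedModule)); [exact IH|].
      replace 0 with (minus (2 * sin (c * (PI / 2)) / c) (2 * sin (c * 0) / c)) at 2.
      2:{ replace (c * (PI / 2)) with (0 + INR (S n) * PI) by (unfold c; field).
          rewrite Rmult_0_r, sin_0.
          assert (E : sin (0 + INR (S n) * PI) = 0).
          { apply sin_eq_0_1. exists (Z.of_nat (S n)). rewrite <- INR_IZR_INZ. ring. }
          rewrite E. unfold minus, plus, opp; simpl. eq_in_R. field. exact Hc. }
      apply (is_RInt_derive (fun x => 2 * sin (c * x) / c)).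
      * intros x _. auto_derive; [easy|]. field. exact Hc.
      * intros x _. apply @ex_derive_continuous. auto_derive. easy.
Qed.

Lemma is_RInt_sin_sum_div_sin (p N : nat) :
  is_RInt (fun x => sin_sum p N x / sin x) 0 (PI / 2) (lambda_sum p N * (PI / 2)).
Proof.
  unfold lambda_sum. rewrite sum_n_Rmult_r.
  apply (is_RInt_ext (fun x => sum_n (fun n => / odd n ^ p * (sin (odd n * x) / sin x)) N)).
  - intros x _. unfold sin_sum, Rdiv at 2. rewrite sum_n_Rmult_r. apply sum_n_ext.
    intros n. unfold Rdiv. rewrite <- Rmult_assoc. f_equal. apply Rmult_comm.
  - apply (is_RInt_sum_n (fun n x => / odd n ^ p * (sin (odd n * x) / sin x))).
    intros n. apply is_RInt_Rmult_l, is_RInt_sin_odd_div_sin.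
Qed.

Lemma continuous_pow_div_sin (n : nat) (x : R) : 0 < x < PI ->
  continuous (fun x => x ^ n / sin x) x.
Proof.
  intros Hx. apply @ex_derive_continuous. auto_derive.
  apply Rgt_not_eq, sin_gt_0; lra.
Qed.

(** The singularity at 0 is removable. The continuous extension supplies integrability up to 0 and
    continuity of the integral in its lower bound. *)
Lemma pow_div_sin_extension (n : nat) : {g : R -> R |
  (forall x, x < PI -> continuous g x) /\
  (forall x, 0 < x -> g x = x ^ S n / sin x)}.
Proof.
  destruct (C0_extension_left (T := R_UniformSpace) (fun x => x ^ S n / sin x) (0 ^ n * / 1) 0 PI)
    as [g [Hc [He _]]].
  - apply PI_RGT_0.
  - intros x Hx. apply (continuous_pow_div_sin (S n) x Hx).
  (* Writing the limit with [0 ^ n] covers [n = 0] as well, where [0 ^ 0] is 1. *)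
  - assert (L : is_lim (fun x => x ^ n * / (sin x / x)) 0 (0 ^ n * / 1)).
    { apply (is_lim_mult _ _ 0 (Finite (0 ^ n)) (Finite (/ 1))).
      - apply is_lim_continuity, derivable_continuous_pt, derivable_pt_pow.
      - apply (is_lim_inv _ 0 (Finite 1)); [apply is_lim_sinc_0|].
        intros E. inversion E. lra.
      - easy. }
    apply (filterlim_ext_loc (fun x => x ^ n * / (sin x / x))).
    + exists (mkposreal 1 Rlt_0_1). intros y Hy H0.
      assert (0 < sin y).
      { apply sin_gt_0; [exact H0|]. unfold ball in Hy; simpl in Hy.
        unfold AbsRing_ball, abs, minus, plus, opp in Hy; simpl in Hy.
        apply Rabs_lt_between in Hy. pose proof PI2_1. lra. }
      simpl pow. field. lra.
    + eapply filterlim_filter_le_1; [|exact L].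
      intros P [d Hd]. exists d. intros y Hy H0. apply Hd; [exact Hy|]. lra.
  - exists g. split; [exact Hc|]. intros x Hx. now apply He.
Qed.

Lemma is_RInt_pow_div_sin (n : nat) :
  is_RInt (fun x => x ^ S n / sin x) 0 (PI / 2) (RInt (fun x => x ^ S n / sin x) 0 (PI / 2)).
Proof.
  pose proof PI_RGT_0 as HPI. apply (RInt_correct (V := R_CompleteNormedModule)).
  destruct (pow_div_sin_extension n) as [g [Hc He]].
  apply (ex_RInt_ext g).
  - rewrite Rmin_left, Rmax_right by lra. intros x Hx. apply He. lra.
  - apply (ex_RInt_continuous (V := R_CompleteNormedModule)).
    rewrite Rmin_left, Rmax_right by lra. intros x Hx. apply Hc. lra.
Qed.

(** The integral of the continuous extension over [[z, PI / 2]] is continuous in [z] at 0, so the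
    improper integral is the ordinary one. *)
Lemma is_RInt_gen_pow_div_sin (n : nat) :
  is_RInt_gen (fun x => x ^ S n / sin x) (at_right 0) (at_point (PI / 2))
    (RInt (fun x => x ^ S n / sin x) 0 (PI / 2)).
Proof.
  pose proof PI_RGT_0 as HPI.
  destruct (pow_div_sin_extension n) as [g [Hc He]].
  assert (ex : forall z, z < PI / 2 -> is_RInt g z (PI / 2) (RInt g z (PI / 2))).
  { intros z Hz. apply (RInt_correct (V := R_CompleteNormedModule)).
    apply (ex_RInt_continuous (V := R_CompleteNormedModule)).
    rewrite Rmin_left, Rmax_right by lra. intros x Hx. apply Hc. lra. }
  replace (RInt (fun x => x ^ S n / sin x) 0 (PI / 2)) with (RInt g 0 (PI / 2)).
  2:{ apply RInt_ext. rewrite Rmin_left, Rmax_right by lra. intros x Hx. apply He. lra. }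
  assert (near : forall y, ball 0 1 y -> y < PI / 2).
  { intros y Hy. unfold ball in Hy; simpl in Hy.
    unfold AbsRing_ball, abs, minus, plus, opp in Hy; simpl in Hy.
    apply Rabs_lt_between in Hy. pose proof PI2_1. lra. }
  assert (cont : continuous (fun z => RInt g z (PI / 2)) 0).
  { apply (continuous_RInt_2 g 0 (PI / 2)).
    exists (mkposreal 1 Rlt_0_1). intros y Hy. apply ex, near, Hy. }
  apply (filterlimi_lim_ext_loc (fun ab => RInt g (fst ab) (PI / 2))).
  - exists (fun a => 0 < a < PI / 2) (fun b => b = PI / 2).
    + exists (mkposreal 1 Rlt_0_1). intros y Hy H0. split; [exact H0|]. apply near, Hy.
    + reflexivity.
    + intros a b Ha ->. cbn [fst snd]. apply (is_RInt_ext g); [|apply ex; lra].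
      rewrite Rmin_left, Rmax_right by lra. intros x Hx. apply He. lra.
  - eapply (filterlim_comp _ _ _ fst (fun z => RInt g z (PI / 2)) _ (at_right 0)).
    + apply filterlim_fst.
    + eapply filterlim_filter_le_1; [|exact cont]. apply filter_le_within.
Qed.

(** This is [J] at a positive integer without the factor [2 / PI]: the integral of
    [monomial n x / sin x]. *)
Definition J_integral (n : nat) : R :=
  RInt (fun x => x ^ n / sin x) 0 (PI / 2) / INR (fact n).

Lemma J_INR (n : nat) : J (INR (S n)) = 2 / PI * J_integral (S n).
Proof.
  unfold J, J_integral. rewrite Gamma_fact.
  replace (RInt_gen _ _ _) with (RInt (fun x => x ^ S n / sin x) 0 (PI / 2)).
  - unfold Rdiv. ring.
  - symmetry. apply is_RInt_gen_unique.
    eapply is_RInt_gen_ext; [|apply is_RInt_gen_pow_div_sin].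
    exists (fun a => 0 < a) (fun b => b = PI / 2).
    + exists (mkposreal 1 Rlt_0_1). now intros y _ H.
    + reflexivity.
    + intros a b Ha -> x. cbn [fst snd]. intros Hx. pose proof PI_RGT_0.
      assert (0 < Rmin a (PI / 2)) by (apply Rmin_pos; lra).
      rewrite Rpower_pow by lra. reflexivity.
Qed.

Lemma is_RInt_monomial_div_sin (n : nat) :
  is_RInt (fun x => monomial (S n) x / sin x) 0 (PI / 2) (J_integral (S n)).
Proof.
  unfold J_integral, Rdiv at 3. rewrite Rmult_comm.
  apply (is_RInt_ext (fun x => / INR (fact (S n)) * (x ^ S n / sin x))).
  - intros x _. unfold monomial, Rdiv. eq_in_R. ring.
  - apply is_RInt_Rmult_l, is_RInt_pow_div_sin.
Qed.

Definition J_sum (p N : nat) : R :=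
  sum_n (fun k => (-1) ^ k * lambda_sum (2 * (S p - k)) N * J_integral (S (2 * k))) p
  + (-1) ^ S p * beta_sum N * J_integral (S (S (2 * p))).

Lemma is_RInt_sin_poly_div_sin (p N : nat) :
  is_RInt (fun x => sin_poly p N x / sin x) 0 (PI / 2) (J_sum p N).
Proof.
  apply (is_RInt_ext (fun x => plus
    (sum_n (fun k => (-1) ^ k * lambda_sum (2 * (S p - k)) N * (monomial (S (2 * k)) x / sin x)) p)
    ((-1) ^ S p * beta_sum N * (monomial (S (S (2 * p))) x / sin x)))).
  - intros x _. unfold sin_poly, Rdiv at 3.
    rewrite Rmult_plus_distr_r, sum_n_Rmult_r. change plus with Rplus. f_equal.
    + apply sum_n_ext. intros k. symmetry. apply Rmult_assoc.
    + symmetry. apply Rmult_assoc.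
  - apply (is_RInt_plus (V := R_NormedModule)).
    + apply (is_RInt_sum_n (fun k x =>
        (-1) ^ k * lambda_sum (2 * (S p - k)) N * (monomial (S (2 * k)) x / sin x))).
      intros k. apply is_RInt_Rmult_l, is_RInt_monomial_div_sin.
    + apply is_RInt_Rmult_l, is_RInt_monomial_div_sin.
Qed.

(** The pointwise error is divided by [sin x] and integrated. Its monomial has positive degree, so
    the quotient is still integrable at 0. *)
Lemma lambda_sum_error (p N : nat) :
  Rabs (lambda_sum (S (2 * S p)) N * (PI / 2) - J_sum p N)
    <= fourier_error N * J_integral (S (2 * p)).
Proof.
  pose proof PI_RGT_0 as HPI.
  assert (I1 := is_RInt_minus (V := R_NormedModule) _ _ _ _ _ _
    (is_RInt_sin_sum_div_sin (S (2 * S p)) N) (is_RInt_sin_poly_div_sin p N)).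
  assert (I2 := is_RInt_Rmult_l _ _ _ (fourier_error N) _ (is_RInt_monomial_div_sin (2 * p))).
  assert (I3 := is_RInt_Rmult_l _ _ _ (-1) _ I2).
  assert (H : forall x, 0 < x < PI / 2 ->
    - (fourier_error N * (monomial (S (2 * p)) x / sin x)) <=
    sin_sum (S (2 * S p)) N x / sin x - sin_poly p N x / sin x <=
    fourier_error N * (monomial (S (2 * p)) x / sin x)).
  { intros x Hx. pose proof (sin_sum_error p N x ltac:(lra)) as E.
    assert (Hs : 0 < / sin x) by (apply Rinv_0_lt_compat, sin_pos_half_PI; lra).
    apply Rabs_le_between in E. unfold Rdiv. split; nra. }
  apply Rabs_le. split.
  - replace (- (fourier_error N * J_integral (S (2 * p)))) with
      (-1 * (fourier_error N * J_integral (S (2 * p)))) by ring.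
    apply (is_RInt_le _ _ 0 (PI / 2) _ _ ltac:(lra) I3 I1).
    intros x Hx. apply H in Hx. change minus with Rminus. lra.
  - apply (is_RInt_le _ _ 0 (PI / 2) _ _ ltac:(lra) I1 I2).
    intros x Hx. apply H in Hx. apply Hx.
Qed.

(** * Passage to the limit *)

Lemma Rpower_odd (n p : nat) : Rpower (2 * INR (S n) - 1) (- INR p) = / odd n ^ p.
Proof.
  replace (2 * INR (S n) - 1) with (odd n) by (unfold odd; rewrite S_INR; ring).
  pose proof (odd_ge_1 n). rewrite Rpower_Ropp, Rpower_pow by lra. reflexivity.
Qed.

Lemma is_lim_seq_inv_INR_S : is_lim_seq (fun n => / INR (S n)) 0.
Proof.
  apply (is_lim_seq_incr_1 (fun n => / INR n)).
  apply (is_lim_seq_inv INR p_infty); [apply is_lim_seq_INR|easy].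
Qed.

Lemma is_series_telescope : is_series (fun n => / INR (S n) - / INR (S (S n))) 1.
Proof.
  change (is_lim_seq (sum_n (fun n => / INR (S n) - / INR (S (S n)))) 1).
  apply (is_lim_seq_ext (fun n => 1 - / INR (S (S n)))).
  - intros n. induction n as [|n IH].
    + rewrite sum_O. simpl. field.
    + rewrite sum_Sn, <- IH. change plus with Rplus. ring.
  - replace (Finite 1) with (Finite (1 - 0)) by (f_equal; ring). apply is_lim_seq_minus'; [apply is_lim_seq_const|].
    apply (is_lim_seq_incr_1 (fun n => / INR (S n))), is_lim_seq_inv_INR_S.
Qed.

(** Comparison with twice the telescoping series, using [(2n+1)^2 >= (n+1)(n+2) / 2]. *)
Lemma ex_series_inv_odd_pow (p : nat) : ex_series (fun n => / odd n ^ S (S p)).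
Proof.
  apply (ex_series_le (V := R_CompleteNormedModule) _
    (fun n => 2 * (/ INR (S n) - / INR (S (S n))))).
  - intros n. unfold norm; simpl norm. pose proof (odd_ge_1 n) as H1.
    pose proof (pos_INR n) as H0.
    assert (H2 : odd n ^ 2 <= odd n ^ S (S p)) by (apply Rle_pow; [exact H1|lia]).
    assert (0 < odd n ^ 2) by (apply pow_lt; lra).
    change (Rabs (/ odd n ^ S (S p)) <= 2 * (/ INR (S n) - / INR (S (S n)))).
    rewrite Rabs_pos_eq by (left; apply Rinv_0_lt_compat; lra).
    eapply Rle_trans; [apply Rinv_le_contravar; [|exact H2]; assumption|].
    rewrite !S_INR.
    replace (2 * (/ (INR n + 1) - / (INR n + 1 + 1))) with
      (/ ((INR n + 1) * (INR n + 1 + 1) / 2)) by (field; lra).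
    apply Rinv_le_contravar; [nra|]. unfold odd. nra.
  - exists (scal 2 1). exact (is_series_scal 2 _ _ is_series_telescope).
Qed.

Lemma is_lim_seq_lambda_sum (p : nat) :
  is_lim_seq (lambda_sum (S (S p))) (dirichlet_lambda (INR (S (S p)))).
Proof.
  apply (is_lim_seq_ext (sum_n (fun n => / odd n ^ S (S p)))); [reflexivity|].
  unfold dirichlet_lambda. rewrite (Series_ext _ (fun n => / odd n ^ S (S p))).
  - exact (Series_correct _ (ex_series_inv_odd_pow p)).
  - intros n. apply Rpower_odd.
Qed.

Lemma is_lim_seq_beta_sum : is_lim_seq beta_sum (dirichlet_beta 1).
Proof.
  assert (ex : ex_series (fun n => (-1) ^ n / odd n)).
  (* [exist_PI] is the convergence of the same alternating series of reciprocals of odd numbers. *)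
  { destruct exist_PI as [l Hl]. exists l.
    change (is_lim_seq (sum_n (fun n => (-1) ^ n / odd n)) l).
    apply (is_lim_seq_ext (fun N => sum_f_R0 (tg_alt PI_tg) N)).
    - intros N. rewrite <- sum_n_Reals. apply sum_n_ext. intros n.
      unfold tg_alt, PI_tg, odd. rewrite plus_INR, mult_INR. reflexivity.
    - now apply is_lim_seq_Reals. }
  apply (is_lim_seq_ext (sum_n (fun n => (-1) ^ n / odd n))); [reflexivity|].
  unfold dirichlet_beta. rewrite (Series_ext _ (fun n => (-1) ^ n / odd n)).
  - exact (Series_correct _ ex).
  - intros n. change (- (1)) with (- INR 1). rewrite Rpower_odd, pow_1. reflexivity.
Qed.

Lemma is_lim_seq_fourier_error : is_lim_seq fourier_error 0.
Proof.
  apply (is_lim_seq_ext (fun N => 16 * sqrt (/ INR (S N)))).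
  - intros N. unfold fourier_error. rewrite sqrt_inv. reflexivity.
  - replace 0 with (16 * sqrt 0) by (rewrite sqrt_0; ring).
    apply is_lim_seq_mult'; [apply is_lim_seq_const|].
    apply (is_lim_seq_continuous sqrt (fun N => / INR (S N)) 0).
    + apply continuity_pt_sqrt. lra.
    + apply is_lim_seq_inv_INR_S.
Qed.

(** Convergence is asked for [k <= n] only: beyond that range the truncated exponent [2 * (S p - k)]
    of the application is 0 and the partial sums of lambda diverge. *)
Lemma is_lim_seq_sum_n (u : nat -> nat -> R) (l : nat -> R) (n : nat) :
  (forall k, (k <= n)%nat -> is_lim_seq (u k) (l k)) ->
  is_lim_seq (fun N => sum_n (fun k => u k N) n) (sum_n l n).
Proof.
  induction n as [|n IH]; intros H.
  - rewrite sum_O. apply (is_lim_seq_ext (u 0%nat)); [|apply H; lia]. intros N. now rewrite sum_O.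
  - rewrite sum_Sn. apply (is_lim_seq_ext (fun N => sum_n (fun k => u k N) n + u (S n) N)).
    + intros N. now rewrite sum_Sn.
    + apply is_lim_seq_plus'; [apply IH; intros k Hk|]; apply H; lia.
Qed.

(** The difference bounded by [lambda_sum_error] tends to the difference of the two sides, and also
    to 0. *)
Lemma dirichlet_lambda_odd (p : nat) :
  dirichlet_lambda (INR (S (2 * S p))) * (PI / 2) =
  sum_n (fun k => (-1) ^ k * dirichlet_lambda (INR (2 * (S p - k))) * J_integral (S (2 * k))) p
  + (-1) ^ S p * dirichlet_beta 1 * J_integral (S (S (2 * p))).
Proof.
  set (l := sum_n _ _ + _).
  assert (L1 : is_lim_seq (fun N => lambda_sum (S (2 * S p)) N * (PI / 2) - J_sum p N)
    (dirichlet_lambda (INR (S (2 * S p))) * (PI / 2) - l)).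
  { apply is_lim_seq_minus'.
    - apply is_lim_seq_mult'; [|apply is_lim_seq_const].
      replace (2 * S p)%nat with (S (S (2 * p))) by lia. apply is_lim_seq_lambda_sum.
    - apply is_lim_seq_plus'.
      + apply (is_lim_seq_sum_n (fun k N =>
          (-1) ^ k * lambda_sum (2 * (S p - k)) N * J_integral (S (2 * k)))).
        intros k Hk. apply is_lim_seq_mult'; [|apply is_lim_seq_const].
        apply is_lim_seq_mult'; [apply is_lim_seq_const|].
        (* Since [k <= p], the exponent is at least 2, which is where the lambda series
           converges. *)
        replace (2 * (S p - k))%nat with (S (S (2 * (p - k)))) by lia.
        apply is_lim_seq_lambda_sum.
      + apply is_lim_seq_mult'; [|apply is_lim_seq_const].
        apply is_lim_seq_mult'; [apply is_lim_seq_const|]. apply is_lim_seq_beta_sum. }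
  assert (L2 : is_lim_seq (fun N => lambda_sum (S (2 * S p)) N * (PI / 2) - J_sum p N) 0).
  { apply is_lim_seq_abs_0.
    apply (is_lim_seq_le_le (fun _ => 0) _ (fun N => fourier_error N * J_integral (S (2 * p)))).
    - intros N. split; [apply Rabs_pos|apply lambda_sum_error].
    - apply is_lim_seq_const.
    - replace 0 with (0 * J_integral (S (2 * p))) by ring.
      apply is_lim_seq_mult'; [apply is_lim_seq_fourier_error|apply is_lim_seq_const]. }
  apply is_lim_seq_unique in L1. apply is_lim_seq_unique in L2.
  rewrite L1 in L2. injection L2 as E. now apply Rminus_diag_uniq.
Qed.

Theorem theorem1 (m : nat) (hm : (1 <= m)%nat) :
  dirichlet_lambda (2 * INR m + 1) =
    sum_n_m (fun k : nat =>
      (-1) ^ (k - 1) * dirichlet_lambda (2 * INR m - 2 * INR k + 2)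
        * J (2 * INR k - 1)) 1 m
    + (-1) ^ m * dirichlet_beta 1 * J (2 * INR m).
Proof.
  destruct m as [|p]; [lia|]. pose proof PI_RGT_0 as HPI.
  pose proof (dirichlet_lambda_odd p) as H.
  replace (2 * INR (S p) + 1) with (INR (S (2 * S p)))
    by (rewrite (S_INR (2 * S p)), mult_INR; simpl (INR 2); ring).
  replace (J (2 * INR (S p))) with (J (INR (S (S (2 * p)))))
    by (f_equal; rewrite !S_INR, mult_INR; simpl (INR 2); ring).
  (* The sum over 1 to [S p] becomes a sum over 0 to [p], with [S k] in place of the index. *)
  rewrite <- sum_n_m_S. fold (sum_n (fun k : nat => (-1) ^ (S k - 1) *
    dirichlet_lambda (2 * INR (S p) - 2 * INR (S k) + 2) * J (2 * INR (S k) - 1)) p).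
  rewrite (sum_n_ext_loc _ (fun k => (-1) ^ k * dirichlet_lambda (INR (2 * (S p - k)))
    * J_integral (S (2 * k)) * (2 / PI))).
  - rewrite <- sum_n_Rmult_r, J_INR.
    (* Multiplying by [PI / 2] cancels the factor [2 / PI] that every value of [J] carries. *)
    apply Rmult_eq_reg_r with (PI / 2); [|lra]. rewrite H. eq_in_R. field. lra.
  - intros k Hk.
    replace (S k - 1)%nat with k by lia.
    replace (2 * INR (S p) - 2 * INR (S k) + 2) with (INR (2 * (S p - k)))
      by (rewrite mult_INR, minus_INR, (S_INR k) by lia; simpl (INR 2); ring).
    replace (2 * INR (S k) - 1) with (INR (S (2 * k)))
      by (rewrite !S_INR, mult_INR; simpl (INR 2); ring).
    rewrite J_INR. eq_in_R. ring.
Qed.
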